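(* Let $\mathcal{A}$ be an abelian category, $\mathcal{C}$ an abelian full subcategory of $\mathcal{A}$ and $i:\mathcal{C}\to \mathcal{A}$ the inclusion functor. (i) Assume that $\mathcal{C}$ is a Giraud subcategory of $\mathcal{A}$. Let $M$ and $N$ be objects of $\mathcal{C}$. Then $N$ is $M$-CS-Rickart in $\mathcal{C}$ if and only if $i(N)$ is $i(M)$-CS-Rickart in $\mathcal{A}$. (ii) Assume that $\mathcal{C}$ is a co-Giraud subcategory of $\mathcal{A}$. Let $M$ and $N$ be objects of $\mathcal{C}$. Then $N$ is dual $M$-CS-Rickart in $\mathcal{C}$ if and only if $i(N)$ is dual $i(M)$-CS-Rickart in $\mathcal{A}$.
   Context: In an abelian category: a morphism $s:A\to B$ is a section (resp. $r:A\to B$ is a retraction) if there is $s':B\to A$ with $s's=1_A$ (resp. $r':B\to A$ with $rr'=1_B$). A monomorphism $f:X\to Y$ is essential if for every morphism $h:Y\to P$ such that $hf$ is a monomorphism, $h$ is a monomorphism. An epimorphism $f:X\to Y$ is superfluous if for every morphism $h:P\to X$ such that $fh$ is an epimorphism, $h$ is an epimorphism. For objects $M,N$ of an abelian category: $N$ is $M$-CS-Rickart if for every morphism $f:M\to N$ there are an essential monomorphism $e:\mathrm{Ker}(f)\to L$ and a section $s:L\to M$ with $\ker(f)=se$. $N$ is dual $M$-CS-Rickart if for every morphism $f:M\to N$ there are a retraction $r:N\to P$ and a superfluous epimorphism $t:P\to \mathrm{Coker}(f)$ with $\mathrm{coker}(f)=tr$. A full subcategory $\mathcal{C}$ of $\mathcal{A}$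 is reflective (coreflective) if the inclusion functor $i:\mathcal{C}\to\mathcal{A}$ has a left (right) adjoint. A reflective subcategory is Giraud if the left adjoint of $i$ preserves kernels; a coreflective subcategory is co-Giraud if the right adjoint of $i$ preserves cokernels. *)

(* Defs.v *)
From mathcomp Require Import all_boot all_algebra.

Set Implicit Arguments.
Unset Strict Implicit.
Unset Printing Implicit Defensive.

Import GRing.Theory.
Local Open Scope ring_scope.

(* Hom groups are [zmodType]s, the library's abelian groups; the choice
   structure these carry is no restriction classically. *)

Reserved Notation "g \oc f" (at level 40, left associativity).

Record preadditive := Preadditive {
  obj :> Type;
  hom : obj -> obj -> zmodType;
  idm : forall X, hom X X;
  comp : forall X Y Z, hom Y Z -> hom X Y -> hom X Z;
  comp1m : forall X Y (f : hom X Y), comp (idm Y) f = f;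
  compm1 : forall X Y (f : hom X Y), comp f (idm X) = f;
  compmA : forall W X Y Z (h : hom Y Z) (g : hom X Y) (f : hom W X),
    comp h (comp g f) = comp (comp h g) f;
  compmDl : forall X Y Z (g1 g2 : hom Y Z) (f : hom X Y),
    comp (g1 + g2) f = comp g1 f + comp g2 f;
  compmDr : forall X Y Z (g : hom Y Z) (f1 f2 : hom X Y),
    comp g (f1 + f2) = comp g f1 + comp g f2
}.

Arguments hom {p} X Y.
Arguments idm {p} X.
Notation "g \oc f" := (comp g f) : ring_scope.

Section Morphisms.
Variable A : preadditive.
Implicit Types X Y Z : A.

Definition mono X Y (f : hom X Y) : Prop :=
  forall W (u v : hom W X), f \oc u = f \oc v -> u = v.

Definition epi X Y (f : hom X Y) : Prop :=
  forall W (u v : hom Y W), u \oc f = v \oc f -> u = v.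

Definition is_section X Y (s : hom X Y) : Prop :=
  exists s' : hom Y X, s' \oc s = idm X.

Definition is_retraction X Y (r : hom X Y) : Prop :=
  exists r' : hom Y X, r \oc r' = idm Y.

Definition essential_mono X Y (f : hom X Y) : Prop :=
  mono f /\ forall P (h : hom Y P), mono (h \oc f) -> mono h.

Definition superfluous_epi X Y (f : hom X Y) : Prop :=
  epi f /\ forall P (h : hom P X), epi (f \oc h) -> epi h.

Definition is_kernel X Y (f : hom X Y) K (k : hom K X) : Prop :=
  f \oc k = 0 /\
  forall W (g : hom W X), f \oc g = 0 -> exists! u : hom W K, k \oc u = g.

Definition is_cokernel X Y (f : hom X Y) Q (q : hom Y Q) : Prop :=
  q \oc f = 0 /\
  forall W (g : hom Y W), g \oc f = 0 -> exists! u : hom Q W, u \oc q = g.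

Definition is_zero_object Z : Prop :=
  (forall X (f : hom Z X), f = 0) /\ (forall X (f : hom X Z), f = 0).

Definition is_biproduct X Y B
    (i1 : hom X B) (i2 : hom Y B) (p1 : hom B X) (p2 : hom B Y) : Prop :=
  [/\ p1 \oc i1 = idm X, p2 \oc i2 = idm Y, p1 \oc i2 = 0, p2 \oc i1 = 0
    & i1 \oc p1 + i2 \oc p2 = idm B].

End Morphisms.

Record abelian (A : preadditive) : Prop := Abelian {
  has_zero_object : exists Z : A, is_zero_object Z;
  has_biproducts : forall X Y : A, exists B (i1 : hom X B) (i2 : hom Y B)
    (p1 : hom B X) (p2 : hom B Y), is_biproduct i1 i2 p1 p2;
  has_kernels : forall (X Y : A) (f : hom X Y),
    exists K (k : hom K X), is_kernel f k;
  has_cokernels : forall (X Y : A) (f : hom X Y),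
    exists Q (q : hom Y Q), is_cokernel f q;
  mono_is_kernel : forall (X Y : A) (m : hom X Y), mono m ->
    exists Z (g : hom Y Z), is_kernel g m;
  epi_is_cokernel : forall (X Y : A) (e : hom X Y), epi e ->
    exists Z (g : hom Z X), is_cokernel g e
}.

(* In an abelian category kernels and cokernels exist and are unique up to
   isomorphism; the two definitions below quantify over every choice of
   (Ker f, ker f), resp. (Coker f, coker f).  They read
   "N is (dual) M-CS-Rickart in A", in the argument order A, M, N. *)
Definition cs_rickart (A : preadditive) (M N : A) : Prop :=
  forall (f : hom M N) (K : A) (k : hom K M), is_kernel f k ->
    exists (L : A) (e : hom K L) (s : hom L M),
      [/\ essential_mono e, is_section s & k = s \oc e].

Definition dual_cs_rickart (A : preadditive) (M N : A) : Prop :=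
  forall (f : hom M N) (Q : A) (q : hom N Q), is_cokernel f q ->
    exists (P : A) (r : hom N P) (t : hom P Q),
      [/\ is_retraction r, superfluous_epi t & q = t \oc r].

(* Plain functors: additivity is not required. *)
Record functor (A B : preadditive) := Functor {
  fobj :> A -> B;
  fmap : forall X Y : A, hom X Y -> hom (fobj X) (fobj Y);
  fmap1 : forall X : A, fmap (idm X) = idm (fobj X);
  fmapM : forall (X Y Z : A) (g : hom Y Z) (f : hom X Y),
    fmap (g \oc f) = fmap g \oc fmap f
}.

(* [adjoint F G]: F is left adjoint to G. *)
Definition adjoint (A B : preadditive) (F : functor A B) (G : functor B A)
    : Prop :=
  exists phi : forall (X : A) (Y : B), hom (F X) Y -> hom X (G Y),
    [/\ forall X Y, bijective (phi X Y),
        forall (X X' : A) (Y : B) (u : hom X' X) (h : hom (F X) Y),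
          phi X' Y (h \oc fmap F u) = phi X Y h \oc u
      & forall (X : A) (Y Y' : B) (v : hom Y Y') (h : hom (F X) Y),
          phi X Y' (v \oc h) = fmap G v \oc phi X Y h].

Definition preserves_kernels (A B : preadditive) (F : functor A B) : Prop :=
  forall (X Y K : A) (f : hom X Y) (k : hom K X),
    is_kernel f k -> is_kernel (fmap F f) (fmap F k).

Definition preserves_cokernels (A B : preadditive) (F : functor A B) : Prop :=
  forall (X Y Q : A) (f : hom X Y) (q : hom Y Q),
    is_cokernel f q -> is_cokernel (fmap F f) (fmap F q).

Section FullSubcategory.
Variables (A : preadditive) (C : A -> Prop).

(* The full subcategory on the objects satisfying C; C is not assumed to be
   closed under isomorphism. *)
Definition full_sub : preadditive :=
  @Preadditive {X : A | C X} (fun X Y => hom (sval X) (sval Y))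
    (fun X => idm (sval X)) (fun X Y Z g f => g \oc f)
    (fun X Y f => comp1m f) (fun X Y f => compm1 f)
    (fun W X Y Z h g f => compmA h g f)
    (fun X Y Z g1 g2 f => compmDl g1 g2 f)
    (fun X Y Z g f1 f2 => compmDr g f1 f2).

Definition incl : functor full_sub A :=
  @Functor full_sub A (fun X => sval X) (fun X Y f => f)
    (fun X => erefl) (fun X Y Z g f => erefl).

(* A left (right) adjoint of [incl] is unique up to natural isomorphism, so
   "the" adjoint preserves (co)kernels iff some adjoint does. *)
Definition giraud : Prop :=
  exists2 F : functor A full_sub, adjoint F incl & preserves_kernels F.

Definition co_giraud : Prop :=
  exists2 G : functor A full_sub, adjoint incl G & preserves_cokernels G.

End FullSubcategory.

(* Main.v *)
From Pilot Require Import Defs.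
From mathcomp Require Import all_boot all_algebra.

(** Let [F] be a reflector onto [C] with unit [eta].  An object is isomorphic
to one of [C] iff its unit is invertible, and for this a left inverse is
enough; hence [C] is closed under retracts up to isomorphism.  Since the
inclusion preserves kernels and monomorphisms, a factorization of a kernel
through an essential monomorphism and a section in the big category transfers
to [C].  Conversely an essential monomorphism [e : K -> L] of [C] stays
essential: if [h \oc e] is mono then so is its image under [F], and
[eta \oc h = F h \oc eta] is a morphism of [C] whose composite with [e] is
[F (h \oc e) \oc eta], a mono.  Part (ii) is part (i) in the opposite
category. *)

Set Implicit Arguments.
Unset Strict Implicit.
Unset Printing Implicit Defensive.

(* [all_algebra] also exports a [hom]. *)
Import Pilot.Defs.
Import GRing.Theory.
Local Open Scope ring_scope.

(** * Monomorphisms, kernels and the functors preserving them *)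

Section Preadditive.
Variable A : preadditive.
Implicit Types X Y Z K L M N : A.

Lemma compm0 X Y Z (g : hom Y Z) : g \oc (0 : hom X Y) = 0.
Proof. by apply: (@addrI _ (g \oc 0)); rewrite -compmDr !addr0. Qed.

Lemma comp0m X Y Z (f : hom X Y) : (0 : hom Y Z) \oc f = 0.
Proof. by apply: (@addrI _ (0 \oc f)); rewrite -compmDl !addr0. Qed.

Lemma compmBr X Y Z (g : hom Y Z) (f1 f2 : hom X Y) :
  g \oc (f1 - f2) = g \oc f1 - g \oc f2.
Proof. by apply: (@addIr _ (g \oc f2)); rewrite -compmDr !subrK. Qed.

Lemma mono_comp X Y Z (g : hom Y Z) (f : hom X Y) :
  mono g -> mono f -> mono (g \oc f).
Proof. by move=> mg mf W u v; rewrite -!compmA => /mg /mf. Qed.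

Lemma mono_compr X Y Z (g : hom Y Z) (f : hom X Y) : mono (g \oc f) -> mono f.
Proof. by move=> m W u v e; apply: m; rewrite -!compmA e. Qed.

Lemma section_mono X Y (s : hom X Y) : is_section s -> mono s.
Proof.
case=> r rs; apply: (@mono_compr _ _ _ r); rewrite rs => W u v.
by rewrite !comp1m.
Qed.

Lemma essential_mono_isor K K' L (e : hom K L) (a : hom K' K) (b : hom K K') :
  a \oc b = idm K -> b \oc a = idm K' ->
  essential_mono e -> essential_mono (e \oc a).
Proof.
move=> ab ba [me ess]; split=> [|P h m].
  by apply: mono_comp => //; apply: section_mono; exists b.
apply: ess; have -> : h \oc e = (h \oc (e \oc a)) \oc b.
  by rewrite -!compmA ab compm1.
by apply: mono_comp => //; apply: section_mono; exists a.
Qed.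

Lemma essential_mono_isol K L L' (e : hom K L) (a : hom L L') (b : hom L' L) :
  a \oc b = idm L' -> b \oc a = idm L ->
  essential_mono e -> essential_mono (a \oc e).
Proof.
move=> ab ba [me ess]; split=> [|P h].
  by apply: mono_comp => //; apply: section_mono; exists b.
rewrite compmA => /ess m; rewrite -[h]compm1 -ab compmA.
by apply: mono_comp => //; apply: section_mono; exists a.
Qed.

Lemma is_kernel_mono X Y (f : hom X Y) K (k : hom K X) :
  is_kernel f k -> mono k.
Proof.
case=> fk0 univ W u v kukv.
have /univ [w [_ wP]] : f \oc (k \oc u) = 0 by rewrite compmA fk0 comp0m.
by rewrite -(wP u) // -(wP v).
Qed.

Lemma is_kernel_unique X Y (f : hom X Y) K (k : hom K X) K' (k' : hom K' X) :
  is_kernel f k -> is_kernel f k' ->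
  exists (a : hom K' K) (b : hom K K'),
    [/\ a \oc b = idm K, b \oc a = idm K' & k' = k \oc a].
Proof.
move=> kerk kerk'.
have [a [ka _]] := kerk.2 _ _ kerk'.1; have [b [kb _]] := kerk'.2 _ _ kerk.1.
exists a, b; split=> //.
- by apply: (is_kernel_mono kerk); rewrite compmA ka kb compm1.
- by apply: (is_kernel_mono kerk'); rewrite compmA kb ka compm1.
Qed.

End Preadditive.

(** Functors come without additivity; but [idm X] is a kernel of [0], so [fmap F 0] composed with an
    identity vanishes. *)
Lemma preserves_kernels0 (A B : preadditive) (F : functor A B) (X Y : A) :
  preserves_kernels F -> fmap F (0 : hom X Y) = 0.
Proof.
move=> pk.
have id_ker : is_kernel (0 : hom X Y) (idm X).
  split=> [|W g _]; first exact: comp0m.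
  by exists g; split=> [|u <-]; rewrite comp1m.
by have [] := pk _ _ _ _ _ id_ker; rewrite fmap1 compm1.
Qed.

(** The zero map out of a zero object is a kernel of [f]; its image is a zero kernel of [fmap F f],
    which forces [u - v = 0]. *)
Lemma preserves_kernels_mono (A B : preadditive) (F : functor A B) (X Y : A)
    (f : hom X Y) :
  (exists Z : A, is_zero_object Z) -> preserves_kernels F ->
  mono f -> mono (fmap F f).
Proof.
move=> [Z [Z0 _]] pk mf.
have ker0 : is_kernel f (0 : hom Z X).
  split=> [|W g fg0]; first exact: compm0.
  exists 0; split=> [|u _].
  - by apply: mf; rewrite fg0 !compm0.
  - by rewrite -[u]comp1m (Z0 _ (idm Z)) comp0m.
have [_ univ] := pk _ _ _ _ _ ker0.
move=> W u v fufv.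
have /univ [w [w0 _]] : fmap F f \oc (u - v) = 0 by rewrite compmBr fufv subrr.
by apply/eqP; rewrite -subr_eq0 -w0 preserves_kernels0 // comp0m.
Qed.

(** * Reflective subcategories and transfer along the inclusion *)

Section Reflective.
Variables (A : preadditive) (C : A -> Prop).
Variables (F : functor A (full_sub C)) (eta : forall X : A, hom X (sval (F X))).

(** The adjunction reduced to universal arrows; morphisms of [full_sub C] are retyped in [A] so that
    they compose with [eta]. *)
Definition is_unit : Prop :=
  [/\ forall X Y (f : hom X Y),
        eta Y \oc f = (fmap F f : hom (sval (F X)) (sval (F Y))) \oc eta X,
      forall X (Y : full_sub C) (g : hom X (sval Y)),
        exists h : hom (sval (F X)) (sval Y), h \oc eta X = g
    & forall X (Y : full_sub C) (h h' : hom (sval (F X)) (sval Y)),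
        h \oc eta X = h' \oc eta X -> h = h'].

Hypothesis eta_unit : is_unit.

(** Extending [s] along [eta L] to [g] makes [s' \oc g] a left inverse; uniqueness of extensions
    makes it two-sided. *)
Lemma unit_inv_retract (L : A) (M : full_sub C) (s : hom L (sval M))
    (s' : hom (sval M) L) :
  s' \oc s = idm L ->
  exists t : hom (sval (F L)) L, t \oc eta L = idm L /\ eta L \oc t = idm _.
Proof.
have [_ ex uniq] := eta_unit.
move=> s's; have [g gs] := ex _ M s.
have tK : s' \oc g \oc eta L = idm L by rewrite -compmA gs.
exists (s' \oc g); split=> //; apply: uniq.
by rewrite -compmA tK compm1 comp1m.
Qed.

(** A test pair out of [W] extends along [eta W] to a pair in [C], where [f] cancels. *)
Lemma incl_mono (X Y : full_sub C) (f : hom X Y) :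
  mono f -> @mono A (sval X) (sval Y) f.
Proof.
have [_ ex uniq] := eta_unit.
move=> mf W u v.
have [u' <-] := ex _ _ u; have [v' <-] := ex _ _ v.
by rewrite !compmA => /uniq /mf ->.
Qed.

Lemma incl_is_kernel (X Y K : full_sub C) (f : hom X Y) (k : hom K X) :
  is_kernel f k -> @is_kernel A (sval X) (sval Y) f (sval K) k.
Proof.
have [_ ex uniq] := eta_unit.
move=> kerk; have mk := incl_mono (is_kernel_mono kerk).
case: kerk => fk0 univ; split=> // W g fg0; have [g' g'E] := ex _ _ g.
have fg'0 : (f : hom (sval X) (sval Y)) \oc g' = 0.
  by apply: uniq; rewrite -compmA g'E fg0 comp0m.
have [u [ku _]] := univ (F W) g' fg'0.
pose u' : hom W (sval K) := (u : hom (sval (F W)) (sval K)) \oc eta W.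
have kuE : (k : hom (sval K) (sval X)) \oc u' = g by rewrite compmA -g'E -ku.
by exists u'; split=> // v kv; apply: mk; rewrite kv.
Qed.

Lemma incl_essential_mono (K L : full_sub C) (e : hom K L) :
  (exists Z : A, is_zero_object Z) -> preserves_kernels F ->
  essential_mono e -> @essential_mono A (sval K) (sval L) e.
Proof.
have [nat _ _] := eta_unit.
move=> A0 pk [me ess]; split=> [|P h mhe]; first exact: incl_mono.
(* Essentiality of [e] only tests morphisms of [C], so [h] is replaced by one with both ends in
   [C]. *)
have m : @mono A _ _ ((fmap F h : hom (sval (F (sval L))) _) \oc eta (sval L)).
  apply: (@incl_mono L (F P)); apply: ess.
  move=> W u v; apply: (_ : @mono A _ _ (_ \oc (e : hom (sval K) (sval L)))).
  (* Naturality, used twice, turns the composite into [fmap F (h \oc e) \oc eta (sval K)], whose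
     second factor is a split mono. *)
  rewrite -nat -compmA nat.
  apply: mono_comp; last first.
    apply: section_mono.
    by have [t [? _]] := unit_inv_retract (comp1m (idm (sval K))); exists t.
  apply: (@incl_mono (F (sval K)) (F P)).
  exact: preserves_kernels_mono.
by move: m; rewrite -nat => /mono_compr.
Qed.

Lemma cs_rickart_incl (M N : full_sub C) :
  (exists Z : A, is_zero_object Z) -> preserves_kernels F ->
  (forall (X Y : full_sub C) (f : hom X Y), exists K (k : hom K X),
     is_kernel f k) ->
  cs_rickart M N <-> cs_rickart (incl C M) (incl C N).
Proof.
move=> A0 pk Cker; split=> [rick f K k kerk | rick f K k /incl_is_kernel kerk].
  (* [K] may lie outside [C], so the hypothesis is applied to a kernel in [C] and carried over by
     the comparison isomorphism. *)
  have [K0 [k0 kerk0]] := Cker M N f.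
  have [L [e [s [ess ss k0E]]]] := rick f K0 k0 kerk0.
  have [a [b [ab ba ->]]] := is_kernel_unique (incl_is_kernel kerk0) kerk.
  exists (sval L), ((e : hom (sval K0) (sval L)) \oc a), s; split=> //.
  - exact: essential_mono_isor ab ba (incl_essential_mono A0 pk ess).
  - by rewrite compmA k0E.
have [L [e [s [ess [s' s's] kE]]]] := rick f (sval K) k kerk.
(* [L] may lie outside [C]; being a retract of [M], it can be replaced by [F L]. *)
have [t [tK Kt]] := unit_inv_retract s's.
have [me' ess'] := essential_mono_isol Kt tK ess.
exists (F L), (eta L \oc e), (s \oc t); split.
- split=> [W|P h mhe W]; first exact: me'.
  by apply: ess'; apply: (@incl_mono K P).
- exists (eta L \oc s'); change (eta L \oc s' \oc (s \oc t) = idm (sval (F L))).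
  by rewrite -compmA [s' \oc _]compmA s's comp1m.
- change (k = s \oc t \oc (eta L \oc e)).
  by rewrite -compmA [t \oc _]compmA tK comp1m.
Qed.

End Reflective.

(** With [eta] the transpose of the identity, [phi] is composition with [eta], so its bijectivity is
    the universal property. *)
Lemma adjoint_unit (A : preadditive) (C : A -> Prop)
    (F : functor A (full_sub C)) :
  adjoint F (incl C) -> exists eta, @is_unit A C F eta.
Proof.
case=> phi [bij natl natr].
have phiE X Y (h : hom (F X) Y) :
    phi X Y h = (h : hom (sval (F X)) (sval Y)) \oc phi X _ (idm (F X)).
  by rewrite -natr compm1.
exists (fun X => phi X _ (idm (F X))); split.
- by move=> X Y f; rewrite -natl comp1m phiE.
- by move=> X Y g; have [h _ hK] := bij X Y; exists (h g); rewrite -phiE hK.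
- by move=> X Y h h'; rewrite -!phiE => /(bij_inj (bij X Y)).
Qed.

(** * Opposite categories and duality *)

Definition op (A : preadditive) : preadditive :=
  @Preadditive A (fun X Y => hom Y X) (fun X => idm X)
    (fun X Y Z g f => f \oc g)
    (fun X Y f => compm1 f) (fun X Y f => comp1m f)
    (fun W X Y Z h g f => esym (compmA f g h))
    (fun X Y Z g1 g2 f => compmDr f g1 g2)
    (fun X Y Z g f1 f2 => compmDl f1 f2 g).

Definition op_functor (A B : preadditive) (F : functor A B) :
    functor (op A) (op B) :=
  @Functor (op A) (op B) F (fun X Y f => fmap F f) (fun X => fmap1 F X)
    (fun X Y Z g f => fmapM F f g).

(** [bijective] is a proposition; choice on [T] extracts an actual inverse, as needed to invert the
    whole family [phi] at once. *)
Lemma bijective_inverse (T : choiceType) (T' : eqType) (f : T -> T') :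
  bijective f -> {g | cancel f g & cancel g f}.
Proof.
move=> bij; have ex y : exists x, f x == y.
  by case: bij => g _ gK; exists (g y); rewrite gK.
have gK : cancel (fun y => xchoose (ex y)) f.
  by move=> y; apply/eqP/(xchooseP (ex y)).
by exists (fun y => xchoose (ex y)) => // x; apply: (bij_inj bij); rewrite gK.
Qed.

(** The transposition is [psi], inverse to [phi]; its naturality follows from that of [phi] by
    injectivity. *)
Lemma adjoint_op (A B : preadditive) (F : functor A B) (G : functor B A) :
  adjoint F G -> adjoint (op_functor G) (op_functor F).
Proof.
case=> phi [bij natl natr].
pose psi Y X : hom X (G Y) -> hom (F X) Y :=
  s2val (bijective_inverse (bij X Y)).
have phiK X Y : cancel (phi X Y) (psi Y X).
  exact: (s2valP (bijective_inverse (bij X Y))).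
have psiK X Y : cancel (psi Y X) (phi X Y).
  exact: (s2valP' (bijective_inverse (bij X Y))).
have psil (Y Y' : B) (X : A) (v : hom Y Y') (h : hom X (G Y)) :
    psi Y' X (fmap G v \oc h) = v \oc psi Y X h.
  by apply: (bij_inj (bij X Y')); rewrite natr !psiK.
have psir (Y : B) (X X' : A) (u : hom X' X) (h : hom X (G Y)) :
    psi Y X' (h \oc u) = psi Y X h \oc fmap F u.
  by apply: (bij_inj (bij X' Y)); rewrite natl !psiK.
exists psi; split=> [Y X | Y Y' X v h | Y X X' u h].
- exact: Bijective (psiK X Y) (phiK X Y).
- exact: psil.
- exact: psir.
Qed.

Lemma dual_cs_rickartE (A : preadditive) (M N : A) :
  dual_cs_rickart M N <-> @cs_rickart (op A) N M.
Proof.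
by split=> rick f Q q /rick [P [x [y [? ? ?]]]]; exists P, y, x; split.
Qed.

Theorem corollary4p1 (A : preadditive) (C : A -> Prop)
    (abA : abelian A) (abC : abelian (full_sub C)) :
  (giraud C ->
     forall M N : full_sub C,
       cs_rickart M N <-> cs_rickart (incl C M) (incl C N)) /\
  (co_giraud C ->
     forall M N : full_sub C,
       dual_cs_rickart M N <-> dual_cs_rickart (incl C M) (incl C N)).
Proof.
split=> [[F /adjoint_unit [eta unitF] pk] M N | [G adj pc] M N].
  apply: cs_rickart_incl unitF _ _ _ pk (has_kernels abC).
  exact: has_zero_object abA.
(* [op (full_sub C)] and [@full_sub (op A) C] are convertible. *)
have [eta unitG] : exists eta, @is_unit (op A) C (op_functor G) eta.
  exact: (@adjoint_unit (op A) C (op_functor G) (adjoint_op adj)).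
apply: (iff_trans (dual_cs_rickartE _ _)).
apply: iff_trans (iff_sym (dual_cs_rickartE _ _)).
apply: (@cs_rickart_incl (op A) C (op_functor G) eta unitG N M).
- by have [Z [Z0 Z1]] := has_zero_object abA; exists Z.
- by move=> X Y K f k; apply: pc.
- by move=> X Y f; apply: (has_cokernels abC).
Qed.
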